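(* Let $\mathcal M$ be a first-order structure and let $G$ be a topological group which is definable in $\mathcal M$ and has a basis for its topology consisting of sets definable in $\mathcal M$. Then the quotient $S^\mu_G(M)$ is a compact Hausdorff space on which the group $G(M)$ acts continuously. The map $g\mapsto \mathrm{tp}(g/M)_\mu$ embeds $G(M)$ as a dense subset of $S^\mu_G(M)$.
   Context: $M$ is the universe of $\mathcal M$; ''definable'' means definable with parameters from $M$; $\mathbb U$ is a sufficiently saturated elementary extension of $\mathcal M$. Topological groups are assumed Hausdorff; the topology on $G$ is a topology on $G(M)$. $S_G(M)$ is the space of complete types over $M$ containing the formula $x\in G$, with its usual logic topology. The infinitesimal type $\mu$ is the partial type over $M$ consisting of all formulas over $M$ that define open neighborhoods of the identity $e$ in $G(M)$. For $G$-formulas $\varphi,\psi$ over $M$, $\varphi\cdot\psi$ is the formula defining $\{ab:\varphi(a),\psi(b)\}$; for $p\in S_G(M)$, $\mu\cdot p=\{\varphi\cdot\psi:\mu\vdash\varphi,\ p\vdash\psi\}$. Write $p\sim_\mu q$ if $\mu\cdot p$ and $\mu\cdot q$ are logically equivalent partial types; $p_\mu$ denotes the $\sim_\mu$-class of $p$, and $S^\mu_G(M)=S_G(M)/{\sim_\mu}$ with the quotient topology. The group $G(M)$ acts on $S_G(M)$ by left translation, this action preserves $\sim_\mu$, and $G(M)$ acts on $S_G^\mu(M)$ by $g\cdot p_\mu=(g\cdot p)_\mu$. The action is continuous if the map $(g,p_\mu)\mapsto g\cdot p_\mu$ from $G(M)\times S^\mu_G(M)$ to $S_G^\mu(M)$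 is continuous. ''Embeds'' means as a topological embedding. *)

(* Defs.v *)
From HB Require Import structures.
From mathcomp Require Import all_boot.
From mathcomp Require Import all_classical topology.

Set Implicit Arguments.
Unset Strict Implicit.
Unset Printing Implicit Defensive.

Local Open Scope classical_set_scope.
Local Open Scope quotient_scope.

Record language := Language {
  fsym : Type;
  farity : fsym -> nat;
  rsym : Type;
  rarity : rsym -> nat }.

Record structure (L : language) := Structure {
  carrier :> Type;
  carrier_inhabited : inhabited carrier;
  finterp : forall f : fsym L, ('I_(farity f) -> carrier) -> carrier;
  rinterp : forall r : rsym L, ('I_(rarity r) -> carrier) -> Prop }.

(** [term L P n] and [formula L P n] are the terms and formulas of the language
    [L] expanded by constants for the elements of [P], with free variables among
    [x_0, ..., x_(n-1)]. The bound variable of [Fex] is [x_0] of its body, the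
    variables of the context being shifted by one. *)
Inductive term (L : language) (P : Type) (n : nat) : Type :=
| Tvar of 'I_n
| Tpar of P
| Tapp (f : fsym L) of ('I_(farity f) -> term L P n).

Inductive formula (L : language) (P : Type) : nat -> Type :=
| Feq n : term L P n -> term L P n -> formula L P n
| Frel n (r : rsym L) : ('I_(rarity r) -> term L P n) -> formula L P n
| Fnot n : formula L P n -> formula L P n
| Fand n : formula L P n -> formula L P n -> formula L P n
| Fex n : formula L P n.+1 -> formula L P n.

Arguments Tvar {L P n}.
Arguments Tpar {L P n}.
Arguments Tapp {L P n}.

Definition fcons (T : Type) (n : nat) (x : T) (v : 'I_n -> T) : 'I_n.+1 -> T :=
  fun i => if unlift ord0 i is Some j then v j else x.

Definition fcat (T : Type) (m n : nat) (v : 'I_m -> T) (w : 'I_n -> T) :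
    'I_(m + n) -> T :=
  fun i => match fintype.split i with inl j => v j | inr k => w k end.

Section Semantics.
Context (L : language) (P : Type) (N : structure L) (h : P -> N).

Fixpoint eval n (v : 'I_n -> N) (t : term L P n) : N :=
  match t with
  | Tvar i => v i
  | Tpar a => h a
  | Tapp f ts => finterp (fun i => eval v (ts i))
  end.

Fixpoint sat n (phi : formula L P n) : ('I_n -> N) -> Prop :=
  match phi with
  | Feq _ t u => fun v => eval v t = eval v u
  | Frel _ r ts => fun v => rinterp (fun i => eval v (ts i))
  | Fnot _ phi => fun v => ~ sat phi v
  | Fand _ phi psi => fun v => sat phi v /\ sat psi v
  | Fex _ phi => fun v => exists x : N, sat phi (fcons x v)
  end.

End Semantics.

Definition elementary (L : language) (M N : structure L) (h : M -> N) : Prop :=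
  forall n (phi : formula L M n) (v : 'I_n -> M),
    sat id phi v <-> sat h phi (h \o v).

(** Realizations are sought in all the elementary extensions of [M], rather than
    in a fixed saturated one. *)
Section PartialTypes.
Context (L : language) (M : structure L) (n : nat).
Implicit Types (S : set (formula L M n)) (phi : formula L M n).

Definition realizes (N : structure L) (h : M -> N) (a : 'I_n -> N) S : Prop :=
  forall phi, S phi -> sat h phi a.

Definition entails S phi : Prop :=
  forall (N : structure L) (h : M -> N), elementary h ->
  forall a : 'I_n -> N, realizes h a S -> sat h phi a.

Definition logically_equivalent S1 S2 : Prop :=
  (forall phi, S2 phi -> entails S1 phi) /\
  (forall phi, S1 phi -> entails S2 phi).

Definition consistent S : Prop :=
  exists (N : structure L) (h : M -> N) (a : 'I_n -> N),
    elementary h /\ realizes h a S.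

Definition complete_type S : Prop :=
  consistent S /\ forall phi, S phi \/ S (Fnot phi).

End PartialTypes.

HB.mixin Record isTopologicalGroup G & Group G & Topological G := {
  mulg_continuous : continuous (fun xy : G * G => (xy.1 * xy.2)%g : G);
  invg_continuous : continuous (fun x : G => x^-1%g) }.

#[short(type="topologicalGroupType")]
HB.structure Definition TopologicalGroup :=
  {G of Group G & Topological G & isTopologicalGroup G}.

(** The injection [dg_point] identifies [G] with [G(M)], a definable subset
    of [M^n] whose multiplication has a definable graph. *)
Record definable_group (L : language) (M : structure L)
    (G : topologicalGroupType) := DefinableGroup {
  dg_dim : nat;
  dg_point : G -> 'I_dg_dim -> M;
  dg_point_inj : injective dg_point;
  dg_dom : formula L M dg_dim;
  dg_domP : forall a, sat id dg_dom a <-> exists g, a = dg_point g;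
  dg_mul : formula L M (dg_dim + (dg_dim + dg_dim));
  dg_mulP : forall a b c, sat id dg_mul (fcat a (fcat b c)) <->
    exists g h, [/\ a = dg_point g, b = dg_point h & c = dg_point (g * h)%g] }.

Arguments dg_point {L M G} d _ _.
Arguments dg_dom {L M G} d.
Arguments dg_mul {L M G} d.

Section DefinableGroup.
Context (L : language) (M : structure L) (G : topologicalGroupType).
Context (D : definable_group M G).
Local Notation n := (dg_dim D).
Local Notation iota := (dg_point D).
Implicit Types (phi psi chi : formula L M n) (U V : set G).

Definition defines phi U : Prop := forall a, sat id phi a <-> (iota @` U) a.

Definition definable U : Prop := exists phi, defines phi U.

Definition is_SG (p : set (formula L M n)) : Prop :=
  complete_type p /\ p (dg_dom D).

Record SG := MkSG { SG_val :> set (formula L M n); SG_prop : is_SG SG_val }.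

Definition mu : set (formula L M n) :=
  [set phi | exists U, [/\ open U, U 1%g & defines phi U]].

Definition mu_prod (p : set (formula L M n)) : set (formula L M n) :=
  [set chi | exists phi psi U V,
    [/\ defines phi U /\ entails mu phi, defines psi V /\ entails p psi &
        defines chi [set (x * y)%g | x in U & y in V]]].

Definition mu_equiv (p q : SG) : Prop :=
  logically_equivalent (mu_prod p) (mu_prod q).

(** The pushforward of [p] under [x |-> g x], that is, the type of [g a] over
    [M] for any realization [a] of [p]. *)
Definition translate (g : G) (p : set (formula L M n)) : set (formula L M n) :=
  [set phi | exists2 chi, p chi &
    defines chi [set x | sat id phi (iota (g * x)%g)]].

Definition tp (g : G) : set (formula L M n) := [set phi | sat id phi (iota g)].

End DefinableGroup.

Arguments is_SG {L M G} D p.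
Arguments defines {L M G} D phi U.
Arguments definable {L M G} D U.
Arguments translate {L M G} D g p.
Arguments tp {L M G} D g.

Section Substitution.
Context (L : language) (P : Type).

Fixpoint tsubst m n (s : 'I_m -> term L P n) (t : term L P m) : term L P n :=
  match t with
  | Tvar i => s i
  | Tpar a => Tpar a
  | Tapp f ts => Tapp f (fun i => tsubst s (ts i))
  end.

Definition slift m n (s : 'I_m -> term L P n) : 'I_m.+1 -> term L P n.+1 :=
  fcons (Tvar ord0) (fun i => tsubst (fun j => Tvar (lift ord0 j)) (s i)).

Fixpoint subst m (phi : formula L P m) :
    forall n, ('I_m -> term L P n) -> formula L P n :=
  match phi with
  | Feq _ t u => fun n s => Feq (tsubst s t) (tsubst s u)
  | Frel _ r ts => fun n s => Frel (fun i => tsubst s (ts i))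
  | Fnot _ phi => fun n s => Fnot (subst phi s)
  | Fand _ phi psi => fun n s => Fand (subst phi s) (subst psi s)
  | Fex _ phi => fun n s => Fex (subst phi (slift s))
  end.

Context (N : structure L) (h : P -> N).

Lemma eval_tsubst m n (s : 'I_m -> term L P n) (v : 'I_n -> N) t :
  eval h v (tsubst s t) = eval h (fun i => eval h v (s i)) t.
Proof.
elim: t => //= f ts IH; congr finterp.
by apply/funext => i; rewrite IH.
Qed.

Lemma eval_slift m n (s : 'I_m -> term L P n) (v : 'I_n -> N) x :
  (fun i => eval h (fcons x v) (slift s i)) =
  fcons x (fun i => eval h v (s i)).
Proof.
apply/funext => i; rewrite /slift /fcons; case: unliftP => [j _|_] /=.
  rewrite eval_tsubst; congr (eval h _ _).
  by apply/funext => k /=; rewrite liftK.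
by rewrite unlift_none.
Qed.

Lemma sat_subst m (phi : formula L P m) n (s : 'I_m -> term L P n) v :
  sat h (subst phi s) v <-> sat h phi (fun i => eval h v (s i)).
Proof.
elim: phi n s v => {m} [m t u|m r ts|m f IH|m f IHf g IHg|m f IH] n s v /=.
- by rewrite !eval_tsubst.
- by under eq_fun do rewrite eval_tsubst.
- by split=> H /IH.
- by split=> -[/IHf ? /IHg].
- by split=> -[x Hx]; exists x; move: Hx; rewrite IH eval_slift.
Qed.

End Substitution.

Section Transfer.
Context (L : language) (P : Type).

Fixpoint Fexn k n : formula L P (k + n) -> formula L P n :=
  match k with
  | 0 => id
  | k'.+1 => fun phi => Fexn (Fex (phi : formula L P (k' + n).+1))
  end.

Lemma fcat0 T n (w : 'I_0 -> T) (v : 'I_n -> T) : fcat w v = v.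
Proof.
apply/funext => i; rewrite /fcat; case: splitP => [[]//|j /= e].
by congr v; apply/val_inj; rewrite /= e.
Qed.

Lemma fcat_cons T k n x (w : 'I_k -> T) (v : 'I_n -> T) :
  fcat (fcons x w) v = fcons x (fcat w v) :> ('I_(k + n).+1 -> T).
Proof.
apply/funext => i; rewrite /fcat /fcons.
case: (unliftP ord0 i) => [j ->|->]; last first.
  case: splitP => [j /= e|j /= e //].
  by have -> : j = ord0; [apply/val_inj; rewrite /= -e|rewrite unlift_none].
case: splitP => [j' e|j' e].
  case: (unliftP ord0 j') => [j0 e0|e0]; last by move: e; rewrite e0.
  move: e; rewrite e0 !lift0 => -[e].
  by case: splitP => [j1 e1|j1 e1]; [congr w; apply/val_inj; rewrite /= -e -e1|
    move: (ltn_ord j0); rewrite -e e1 ltnNge leq_addr].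
move: e; rewrite lift0 addSn => -[e].
case: splitP => [j1 e1|j1 e1].
  by move: (ltn_ord j1); rewrite -e1 e ltnNge leq_addr.
by congr v; apply/val_inj; apply: (@addnI k); rewrite -e1 -e.
Qed.

Lemma fcat_lshift T m n (v : 'I_m -> T) (w : 'I_n -> T) i :
  fcat v w (lshift n i) = v i.
Proof. by rewrite /fcat (unsplitK (inl i)). Qed.

Lemma fcat_rshift T m n (v : 'I_m -> T) (w : 'I_n -> T) i :
  fcat v w (rshift m i) = w i.
Proof. by rewrite /fcat (unsplitK (inr i)). Qed.

Lemma fcatE T U (f : T -> U) m n (v : 'I_m -> T) (w : 'I_n -> T) :
  (fun i => f (fcat v w i)) = fcat (fun i => f (v i)) (fun i => f (w i)).
Proof. by apply/funext => i; rewrite /fcat; case: fintype.split. Qed.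

Lemma fcons_eta T k (w : 'I_k.+1 -> T) :
  w = fcons (w ord0) (fun i => w (lift ord0 i)).
Proof. by apply/funext => i; rewrite /fcons; case: unliftP => [j|] ->. Qed.

Lemma sat_Fexn (N : structure L) (h : P -> N) k n (phi : formula L P (k + n)) v :
  sat h (Fexn phi) v <-> exists w : 'I_k -> N, sat h phi (fcat w v).
Proof.
elim: k phi => [|k IH] phi /=.
  split=> [H|[w]]; last by rewrite fcat0.
  by exists (fun i : 'I_0 => False_rect _ (notF (ltn_ord i))); rewrite fcat0.
rewrite IH /=; split=> [[w [x H]]|[w H]].
  by exists (fcons x w); rewrite fcat_cons.
exists (fun i => w (lift ord0 i)), (w ord0).
by rewrite -fcat_cons -fcons_eta.
Qed.

End Transfer.

Lemma elementary_id L (M : structure L) : elementary (@id M).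
Proof. by []. Qed.

Lemma elementary_impl L (M N : structure L) (h : M -> N) n
    (phi psi : formula L M n) : elementary h ->
  (forall a, sat id phi a -> sat id psi a) ->
  forall a, sat h phi a -> sat h psi a.
Proof.
move=> hh H a pa; apply: contrapT => qa.
pose f : formula L M (n + 0) := subst (Fand phi (Fnot psi))
  (fun i => Tvar (lshift 0 i)).
pose v0 := fun i : 'I_0 => False_rect M (notF (ltn_ord i)).
have fP (K : structure L) (k : M -> K) (b : 'I_n -> K) v :
    sat k f (fcat b v) <-> sat k (Fand phi (Fnot psi)) b.
  rewrite /f sat_subst; under eq_fun do rewrite /= fcat_lshift.
  by [].
have : sat h (Fexn f) (h \o v0) by apply/sat_Fexn; exists a; apply/fP.
by move/hh/sat_Fexn => [b /fP /= [/H]].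
Qed.

Section TypeSpace.
Context (L : language) (M : structure L) (G : topologicalGroupType).
Context (D : definable_group M G).
Local Notation n := (dg_dim D).
Local Notation iota := (dg_point D).
Implicit Types (phi psi chi : formula L M n) (U V : set G).
Implicit Types (p : set (formula L M n)).

Lemma is_SG_and p phi psi : is_SG D p -> p (Fand phi psi) <-> p phi /\ p psi.
Proof.
move=> -[[[N [h [a [hh ap]]]] pc] _].
have pE chi : p chi <-> sat h chi a.
  split=> [/ap//|H]; case: (pc chi) => // /ap /=.
  by move/(_ H).
by rewrite !pE.
Qed.

(** The formula over [M] defining, for [g] in [G(M)], the set of those [x] in
    [G] such that [phi(g x)]. *)
Definition Ftrans (g : G) phi : formula L M n :=
  Fexn (Fand
    (subst (dg_mul D) (fcat (fun i => Tpar (iota g i))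
      (fcat (fun i => Tvar (rshift n i)) (fun i => Tvar (lshift n i)))))
    (subst phi (fun i => Tvar (lshift n i)))).

Lemma sat_Ftrans (N : structure L) (h : M -> N) g phi (a : 'I_n -> N) :
  sat h (Ftrans g phi) a <-> exists c : 'I_n -> N,
    sat h (dg_mul D) (fcat (h \o iota g) (fcat a c)) /\ sat h phi c.
Proof.
rewrite /Ftrans sat_Fexn.
have E (c : 'I_n -> N) : (fun i => eval h (fcat c a) (fcat
    (fun i => Tpar (iota g i)) (fcat (fun i => Tvar (rshift n i))
     (fun i => Tvar (lshift n i))) i)) = fcat (h \o iota g) (fcat a c).
  rewrite (fcatE (eval h (fcat c a))) (fcatE (eval h (fcat c a))) /=.
  congr (fcat _ (fcat _ _)); apply/funext => i /=.
    exact: fcat_rshift.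
  exact: fcat_lshift.
have E' (c : 'I_n -> N) :
    (fun i => eval h (fcat c a) (Tvar (lshift n i))) = c.
  by apply/funext => i /=; exact: fcat_lshift.
by split=> -[c /= H]; exists c; move: H; rewrite !sat_subst E E'.
Qed.

Lemma defines_Ftrans g phi :
  defines D (Ftrans g phi) [set x | sat id phi (iota (g * x)%g)].
Proof.
move=> a; rewrite sat_Ftrans; split=> [[c [/dg_mulP[g' [x [e -> ->]]] H]]|].
  exists x => //=; rewrite (_ : g = g') //.
  exact: (@dg_point_inj _ _ _ D).
move=> [x /= H <-]; exists (iota (g * x)%g); split=> //.
by apply/dg_mulP; exists g, x.
Qed.

Lemma is_SG_translate g p : is_SG D p -> is_SG D (translate D g p).
Proof.
move=> -[[[N [h [a [hh ap]]]] pc] pdom].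
have pE chi : p chi <-> sat h chi a.
  split=> [/ap//|H]; case: (pc chi) => // /ap /=.
  by move/(_ H).
have definesE chi chi' U : defines D chi U -> defines D chi' U ->
    p chi <-> p chi'.
  move=> H H'; rewrite !pE.
  split=> Hc; apply: (elementary_impl hh _ Hc) => b Hb.
    by apply/(H' b)/(H b).
  by apply/(H b)/(H' b).
have tE phi : translate D g p phi <-> p (Ftrans g phi).
  split=> [[chi pchi H]|H].
    exact/(definesE _ _ _ H (defines_Ftrans g phi)).
  by exists (Ftrans g phi) => //; exact: defines_Ftrans.
have tdom : translate D g p (dg_dom D).
  exists (dg_dom D) => // b; split=> [/dg_domP[x ->]|[x _ <-]].
    by exists x => //=; apply/dg_domP; exists (g * x)%g.
  by apply/dg_domP; exists x.
have [c [abc cdom]] := (sat_Ftrans h g (dg_dom D) a).1 ((pE _).1 ((tE _).1 tdom)).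
split=> //; split.
  exists N, h, c; split=> // phi [chi /pE pchi chiP].
  pose f : formula L M (n + n) := Fand
    (subst (dg_mul D) (fcat (fun i => Tpar (iota g i)) (fun i => Tvar i)))
    (subst chi (fun i => Tvar (lshift n i))).
  pose f' : formula L M (n + n) := subst phi (fun i => Tvar (rshift n i)).
  have fP (K : structure L) (k : M -> K) (b d : 'I_n -> K) :
      sat k f (fcat b d) <->
      sat k (dg_mul D) (fcat (k \o iota g) (fcat b d)) /\ sat k chi b.
    rewrite /= !sat_subst (fcatE (eval k (fcat b d))) /=.
    by under [X in _ /\ sat k chi X]eq_fun do rewrite /= fcat_lshift.
  have f'P (K : structure L) (k : M -> K) (b d : 'I_n -> K) :
      sat k f' (fcat b d) <-> sat k phi d.
    by rewrite /f' !sat_subst; under eq_fun do rewrite /= fcat_rshift.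
  apply/(f'P _ _ a c)/(elementary_impl hh _ (phi := f)); last exact/fP.
  move=> v.
  have -> : v = fcat (fun i => v (lshift n i)) (fun i => v (rshift n i)).
    by apply/funext => i; rewrite /fcat; case: split_ordP => j ->.
  move/fP => [/dg_mulP[g' [x [/= e eb ec]]] /chiP[x' H e']].
  apply/f'P; rewrite ec; move: H => /=.
  have -> : g' = g by apply: (@dg_point_inj _ _ _ D); rewrite -e.
  have -> // : x' = x by apply: (@dg_point_inj _ _ _ D); rewrite e'.
move=> phi; case: (pc (Ftrans g phi)) => H; first by left; apply/tE.
right; apply/tE/pE/sat_Ftrans; exists c; split=> //= cphi.
move/pE: H => /=; apply; apply/sat_Ftrans.
by exists c.
Qed.

Definition ltrans (g : G) (p : SG D) : SG D :=
  MkSG (is_SG_translate g (SG_prop p)).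

Lemma is_SG_tp g : is_SG D (tp D g).
Proof.
split; last by apply/dg_domP; exists g.
split; last by move=> phi; exact: EM.
by exists M, id, (iota g); split=> //; exact: elementary_id.
Qed.

Definition tpG (g : G) : SG D := MkSG (is_SG_tp g).

HB.instance Definition _ := gen_eqMixin (SG D).
HB.instance Definition _ := gen_choiceMixin (SG D).

(** The logic topology: the sets of types containing a given
    formula form a basis. *)
Definition SG_open : set (set (SG D)) :=
  [set U | forall p : SG D, U p ->
    exists phi, SG_val p phi /\ [set q : SG D | SG_val q phi] `<=` U].

Lemma SG_openT : SG_open setT.
Proof. by move=> p _; exists (dg_dom D); split=> //; case: (SG_prop p). Qed.

Lemma SG_openI : setI_closed SG_open.
Proof.
move=> U V oU oV p [/oU[phi [pphi H]] /oV[psi [ppsi H']]].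
exists (Fand phi psi); split; first exact/(is_SG_and _ _ (SG_prop p)).
by move=> q /(is_SG_and _ _ (SG_prop q))[? ?]; split; [exact: H|exact: H'].
Qed.

Lemma SG_open_bigU (I : Type) (f : I -> set (SG D)) :
  (forall i, SG_open (f i)) -> SG_open (\bigcup_i f i).
Proof.
move=> of_ p [i _ /of_[phi [pphi H]]]; exists phi; split=> // q /H.
by exists i.
Qed.

HB.instance Definition _ :=
  isOpenTopological.Build (SG D) SG_openT SG_openI SG_open_bigU.

Definition mu_equivb (p q : SG D) : bool := `[< mu_equiv p q >].

Lemma mu_equivb_refl : reflexive mu_equivb.
Proof. by move=> p; apply/asboolP; split=> phi H N h hh a /(_ _ H). Qed.

Lemma mu_equivb_sym : symmetric mu_equivb.
Proof. by move=> p q; apply/asbool_equiv_eq; split=> -[]. Qed.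

Lemma mu_equivb_trans : transitive mu_equivb.
Proof.
move=> q p r /asboolP[qp pq] /asboolP[rq qr]; apply/asboolP.
split=> phi H N h hh a ra.
  by apply: (rq phi H N h hh) => psi /qp /(_ N h hh a ra).
by apply: (pq phi H N h hh) => psi /qr /(_ N h hh a ra).
Qed.

Canonical mu_equiv_rel :=
  EquivRel mu_equivb mu_equivb_refl mu_equivb_sym mu_equivb_trans.

Definition Smu : topologicalType := quotient_topology {eq_quot mu_equiv_rel}.

Definition mu_class (p : SG D) : Smu := \pi_({eq_quot mu_equiv_rel}) p.

(** Computed on the chosen representative of [x]; it does not depend on it
    when the topology of [G] has a basis of definable sets. *)
Definition mu_act (g : G) (x : Smu) : Smu :=
  mu_class (ltrans g (repr (x : {eq_quot mu_equiv_rel}))).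

Definition tpmu (g : G) : Smu := mu_class (tpG g).

End TypeSpace.

Definition topological_embedding (X Y : topologicalType) (f : X -> Y) : Prop :=
  [/\ injective f, continuous f &
      forall U, open U -> exists2 V, open V & f @` U = V `&` range f].

(* Main.v *)
Require Import Defs.
From mathcomp Require Import all_boot.
From mathcomp Require Import all_classical topology.

(** A complete type [p] containing [x \in G] is identified with the filter on
    [G(M)] generated by the traces of its formulas, an ultrafilter on the
    Boolean algebra of definable sets. The ultrapower of [M] by an ultrafilter
    on [M^n] provides the compactness theorem, by which semantic entailment
    from a partial type becomes membership in the filter that it generates.
    Thus [mu . p] becomes the filter generated by the sets [U V] with [U] a
    neighborhood of [1] and [V] in [p], and [p ~ q] holds as soon as [U V] meets
    [W] for all such [U], all [V] in [p] and all [W] in [q].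

    For [A] contained in [G(M)], the set of the [p] with [A] in [mu . p] is open
    and saturated; two inequivalent types are separated by two such sets. By
    compactness of the type space, a saturated open neighborhood of [p] contains
    [{r | U V in r}] for some [U] and [V] as above, which yields the continuity
    of the action. That of [g |-> tp(g)_mu] follows since it is the orbit map of
    [tp(1)_mu]. *)

Set Implicit Arguments.
Unset Strict Implicit.
Unset Printing Implicit Defensive.

Local Open Scope classical_set_scope.

(** With this, [cid] picks the same witness for equal predicates, so equivalent functions will
    receive one common representative. *)
Lemma sval_cid_eq (T : Type) (P Q : T -> Prop) (p : exists x, P x)
  (q : exists x, Q x) : P = Q -> sval (cid p) = sval (cid q).
Proof. by move=> PQ; subst Q; rewrite (Prop_irrelevance p q). Qed.

(** * Ultrapowers of [M] and the theorem of Los *)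

Section Ultrapower.
Context (L : language) (M : structure L) (I : Type).
Context (F : set_system I) (FF : UltraFilter F).

Definition eq_mod (f g : I -> M) : Prop := F [set i | f i = g i].

Lemma ultrafilterW : Filter F.
Proof. exact: _. Qed.

Lemma eq_mod_refl f : eq_mod f f.
Proof. by apply: filterS filterT => i _. Qed.

Lemma eq_mod_sym f g : eq_mod f g -> eq_mod g f.
Proof. by apply: filterS => i /= ->. Qed.

Lemma eq_mod_trans g f h : eq_mod f g -> eq_mod g h -> eq_mod f h.
Proof. by apply: filterS2 => i /= -> ->. Qed.

Definition germ_repr (f : I -> M) : I -> M :=
  sval (cid (ex_intro (eq_mod f) f (eq_mod_refl f))).

Lemma eq_mod_germ_repr f : eq_mod f (germ_repr f).
Proof. by rewrite /germ_repr; case: cid. Qed.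

Lemma germ_repr_eq f g : eq_mod f g -> germ_repr f = germ_repr g.
Proof.
move=> fg; apply: sval_cid_eq; apply/funext => k; apply/propext.
by split; apply: eq_mod_trans => //; exact: eq_mod_sym.
Qed.

(** Germs are encoded as the fixed points of [germ_repr], which keeps the
    ultrapower in the universe of [I -> M]. *)
Definition germ := {f : I -> M | germ_repr f = f}.

Lemma germ_repr_idem f : germ_repr (germ_repr f) = germ_repr f.
Proof. by apply/germ_repr_eq/eq_mod_sym/eq_mod_germ_repr. Qed.

Definition to_germ (f : I -> M) : germ :=
  exist _ (germ_repr f) (germ_repr_idem f).

Lemma to_germ_eq f g : to_germ f = to_germ g <-> eq_mod f g.
Proof.
split=> [/(congr1 sval) /= e|/germ_repr_eq e].
  apply: eq_mod_trans (eq_mod_germ_repr f) _.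
  by rewrite e; apply/eq_mod_sym/eq_mod_germ_repr.
rewrite /to_germ; move: (germ_repr_idem f) (germ_repr_idem g); rewrite e => p q.
by rewrite (Prop_irrelevance p q).
Qed.

Lemma sval_to_germK (x : germ) : to_germ (sval x) = x.
Proof.
case: x => f fE /=; rewrite /to_germ.
move: (germ_repr_idem f); rewrite fE => p; by rewrite (Prop_irrelevance p fE).
Qed.

Lemma germ_inhabited : inhabited germ.
Proof.
by case: (carrier_inhabited M) => m; split; exact: to_germ (fun=> m).
Qed.

Definition ultrapower : structure L :=
  @Structure L germ germ_inhabited
    (fun f args => to_germ (fun i => finterp (fun j => sval (args j) i)))
    (fun r args => F [set i | rinterp (fun j => sval (args j) i)]).

Definition const_germ (m : M) : ultrapower := to_germ (fun=> m).

(** A function symbol has finitely many arguments, so the sets of [F] on which each of them is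
    computed correctly intersect in a set of [F]. *)
Lemma filter_eval n (t : term L M n) (v : 'I_n -> ultrapower) :
  F [set i | sval (Defs.eval const_germ v t) i =
             Defs.eval id (fun j => sval (v j) i) t].
Proof.
elim: t => [j|m|f ts IH] /=; first exact: eq_mod_refl.
  exact/eq_mod_sym/eq_mod_germ_repr.
apply: filterS2 (filter_forall ultrafilterW IH) (eq_mod_germ_repr
  (fun i => finterp (fun j => sval (Defs.eval const_germ v (ts j)) i))).
by move=> i /= e <-; congr finterp; apply/funext => j; exact: e.
Qed.

Lemma filter_fcons n (phi : formula L M n.+1) x (v : 'I_n -> ultrapower) :
  [set i | sat id phi (fun j => sval (fcons x v j) i)] =
  [set i | sat id phi (fcons (sval x i) (fun j => sval (v j) i))].
Proof.
apply/funext => i /=; congr sat; apply/funext => j.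
by rewrite /fcons; case: unlift.
Qed.

(** Induction on the formula: negation uses that [F] is ultra, and the quantifier uses a choice of
    witnesses index by index. *)
Lemma los n (phi : formula L M n) (v : 'I_n -> ultrapower) :
  sat const_germ phi v <-> F [set i | sat id phi (fun j => sval (v j) i)].
Proof.
elim: phi v => {n} [n t u|n r ts|n f IH|n f IHf g IHg|n f IH] v /=.
- have tP := filter_eval t v; have uP := filter_eval u v; split=> [tu|H].
    by apply: filterS2 tP uP => i /= <- <-; rewrite tu.
  rewrite -(sval_to_germK (Defs.eval const_germ v t)).
  rewrite -(sval_to_germK (Defs.eval const_germ v u)).
  apply/to_germ_eq; apply: filterS3 tP uP H.
  by move=> i /= -> ->.
- have tsP := filter_forall ultrafilterW (fun j => filter_eval (ts j) v).
  by split; apply: filterS2 tsP => i /= /funext ->.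
- pose A := [set i | sat id f (fun j => sval (v j) i)].
  rewrite IH; split=> [|H H']; first by case: (in_ultra_setVsetC A FF).
  by have /filter_ex[i []] : F (_ `&` _) := @filterI _ _ ultrafilterW _ _ H H'.
- rewrite IHf IHg; split=> [[]|H]; first exact: filterI.
  by split; apply: filterS H => i [].
- split=> [[x /IH]|H].
    by rewrite filter_fcons; apply: filterS => i; exists (sval x i).
  (* [m0] is the default value at the indices that have no witness. *)
  have [m0] := carrier_inhabited M.
  have /choice[x xP] : forall i, exists y,
      (exists y, sat id f (fcons y (fun j => sval (v j) i))) ->
      sat id f (fcons y (fun j => sval (v j) i)).
    move=> i.
    have [[y yP]|] := EM (exists y, sat id f (fcons y (fun j => sval (v j) i))).
      by exists y.
    by exists m0.
  exists (to_germ x); apply/IH; rewrite filter_fcons.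
  apply: filterS2 H (eq_mod_germ_repr x) => i /= /xP.
  by move=> + <-.
Qed.

Lemma elementary_const_germ : elementary const_germ.
Proof.
move=> n phi v; rewrite los.
(* The chosen representative of a constant germ need not be constant, but it agrees with the
   constant on a set of [F]; finitely many coordinates are handled at once. *)
have E : F [set i | forall j, germ_repr (fun=> v j) i = v j].
  by apply: filter_forall => j; exact/eq_mod_sym/eq_mod_germ_repr.
split=> H.
  by apply: filterS E => i /= /funext ->.
have /filter_ex[i [/=]] : F (_ `&` _) := @filterI _ _ ultrafilterW _ _ E H.
by move=> /funext ->.
Qed.

End Ultrapower.

(** * Compactness: consistency and entailment through filters on [M^n] *)

Section Compactness.
Context (L : language) (M : structure L) (n : nat).
Implicit Types (S : set (formula L M n)) (F : set_system ('I_n -> M)).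

(** The germs of the coordinate functions on [M^n], along an ultrafilter extending [F], realize
    [S]. *)
Lemma filter_consistent F S : ProperFilter F ->
  (forall phi, S phi -> F [set a | sat id phi a]) -> consistent S.
Proof.
move=> /ultraFilterLemma[H [HU FH]] FS.
pose x (j : 'I_n) : ultrapower M HU := to_germ HU (fun a => a j).
exists (ultrapower M HU), (const_germ HU), x; split.
  exact: elementary_const_germ.
move=> phi /FS/FH Hphi; apply/los.
have : H [set a | forall j, a j = sval (x j) a].
  by apply: filter_forall => j; exact: eq_mod_germ_repr.
by apply: filterS2 Hphi => a /= aphi /funext <-.
Qed.

Lemma entails_filter F S phi : Filter F ->
  (forall psi, S psi -> F [set a | sat id psi a]) -> entails S phi ->
  F [set a | sat id phi a].
Proof.
move=> FF FS Sphi; apply: contrapT => Fphi.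
(* The filter generated by [F] and the set of tuples refuting [phi]; it is proper exactly because
   the solution set of [phi] is not in [F]. *)
pose H : set_system ('I_n -> M) :=
  fun A => F ([set a | sat id phi a] `|` A).
have HF : ProperFilter H.
  split; first by rewrite /H /= setU0.
  split; rewrite /H.
  - by rewrite setUT; exact: filterT.
  - by move=> A B; rewrite setUIr; exact: filterI.
  - by move=> A B AB; apply: filterS => a [|/AB]; [left|right].
have [N [h [a [hh aS]]]] : consistent (S `|` [set Fnot phi]).
  apply: filter_consistent HF _ => psi [/FS|->]; rewrite /H /=.
    by apply: filterS => a ?; right.
  by apply: filterS filterT => a _ /=; exact: EM.
have := aS (Fnot phi) (or_intror erefl); apply.
by apply: Sphi hh _ _ => psi Spsi; apply: aS; left.
Qed.

End Compactness.

(** * Complete types as filters on the group, and compactness of the type space *)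

Section Types.
Context (L : language) (M : structure L) (G : topologicalGroupType).
Context (D : definable_group M G).
Local Notation n := (dg_dim D).
Local Notation iota := (dg_point D).
Implicit Types (phi psi chi : formula L M n) (U V A B : set G) (p q r : SG D).

Definition smul U V : set G := [set (x * y)%g | x in U & y in V].

Lemma definesE phi V x : defines D phi V -> sat id phi (iota x) <-> V x.
Proof.
move=> phiV; split=> [/phiV[y Vy /dg_point_inj <-]//|Vx].
by apply/phiV; exists x.
Qed.

Definition trace phi : set G := [set x | sat id phi (iota x)].

Lemma defines_trace phi : defines D (Fand phi (dg_dom D)) (trace phi).
Proof.
move=> a; split=> /= [[phia /dg_domP[x xa]]|[x phix <-]].
  by exists x => //; rewrite /trace /= -xa.
by split=> //; apply/dg_domP; exists x.
Qed.

Lemma definable_trace phi : definable D (trace phi).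
Proof. by exists (Fand phi (dg_dom D)); exact: defines_trace. Qed.

Lemma defines_traceE phi V : defines D phi V -> trace phi = V.
Proof. by move=> phiV; apply/funext => x; apply/propext; exact: definesE. Qed.

(** An implication valid in [M] remains valid at a realization of [p] in an elementary extension,
    and [p] is complete. *)
Lemma SG_impl p phi psi :
  (forall a, sat id phi a -> sat id psi a) -> SG_val p phi -> SG_val p psi.
Proof.
move=> H pphi; case: p pphi => S [[[N [h [a [hh aS]]]] Sc] _] /= Sphi.
case: (Sc psi) => // /aS /= npsi; exfalso; apply: npsi.
exact: elementary_impl hh H _ (aS _ Sphi).
Qed.

(** If [phi] had no point in the group, [dg_dom D] would imply its negation in every elementary
    extension, also at a realization of [p]. *)
Lemma SG_sat p phi : SG_val p phi -> exists x, sat id phi (iota x).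
Proof.
move=> pphi; have pdom := (SG_prop p).2.
have [[[N [h [a [hh ap]]]] _] _] := SG_prop p.
apply: contrapT => nphi.
have : sat h (Fnot phi) a.
  apply: elementary_impl hh _ _ (ap _ pdom) => b /dg_domP[x ->] /= phix.
  by apply: nphi; exists x.
by apply; exact: ap.
Qed.

Definition type_filter p : set_system G :=
  [set A | exists2 phi, SG_val p phi & trace phi `<=` A].

(** Conjunction with [dg_dom D] turns an inclusion of traces into an implication between formulas on
    all of [M^n]. *)
Lemma type_filterP p phi : type_filter p (trace phi) <-> SG_val p phi.
Proof.
split=> [[psi ppsi H]|]; last by exists phi.
have : SG_val p (Fand psi (dg_dom D)).
  by apply/(is_SG_and _ _ (SG_prop p)); split=> //; exact: (SG_prop p).2.
by apply: SG_impl => a /= [+ /dg_domP[x xa]]; rewrite xa => /H.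
Qed.

Global Instance type_filter_proper p : ProperFilter (type_filter p).
Proof.
split; first by move=> [phi /SG_sat[x phix] /(_ _ phix)].
split.
- by exists (dg_dom D) => //; exact: (SG_prop p).2.
- move=> A B [phi pphi phiA] [psi ppsi psiB].
  exists (Fand phi psi); first exact/(is_SG_and _ _ (SG_prop p)).
  by move=> x [/phiA Ax /psiB Bx].
- by move=> A B AB [phi pphi phiA]; exists phi => // x /phiA/AB.
Qed.

Lemma type_filter_definable p A : type_filter p A ->
  exists V, [/\ definable D V, type_filter p V & V `<=` A].
Proof.
move=> [phi pphi phiA]; exists (trace phi); split=> //; last by exists phi.
exact: definable_trace.
Qed.

(** Completeness of [p] in terms of filters: the filter is ultra with respect to definable sets. *)
Lemma type_filter_setC p V :
  definable D V -> ~ type_filter p V -> type_filter p (~` V).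
Proof.
move=> [phi phiV] pV.
have [pphi|pphi] := (SG_prop p).1.2 phi.
  by exfalso; apply: pV; exists phi => //; rewrite (defines_traceE phiV).
by exists (Fnot phi) => // x; rewrite /trace /= (definesE _ phiV).
Qed.

Lemma SG_eq p q : type_filter p = type_filter q -> p = q.
Proof.
move=> pq; have {}pq : SG_val p = SG_val q.
  by apply/funext => phi; apply/propext; rewrite -!type_filterP pq.
case: p q pq => [S HS] [S' HS'] /= e; subst S'.
by rewrite (Prop_irrelevance HS HS').
Qed.

Lemma type_filter_ltrans g p A :
  type_filter (ltrans g p) A <-> type_filter p [set x | A (g * x)%g].
Proof.
split=> [[phi [chi pchi chiP] phiA]|[chi pchi chiA]].
  by exists chi => // x chix; apply: phiA; exact: (definesE x chiP).1.
(* This formula cuts out the translate of [trace chi] by [g], whose preimage under left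
   multiplication by [g] is [trace chi] again. *)
exists (Ftrans g^-1%g chi); last first.
  move=> x; rewrite /trace /= (definesE _ (defines_Ftrans _ chi)) /=.
  by move=> /chiA /=; rewrite mulVKg.
exists (Fand chi (dg_dom D)).
  by apply/(is_SG_and _ _ (SG_prop p)); split=> //; exact: (SG_prop p).2.
suff -> : [set x | sat id (Ftrans g^-1%g chi) (iota (g * x)%g)] = trace chi.
  exact: defines_trace.
apply/funext => x; apply/propext => /=.
by rewrite (definesE _ (defines_Ftrans _ chi)) /= mulKg.
Qed.

Lemma ltrans1 p : ltrans 1%g p = p.
Proof.
apply: SG_eq; apply/funext => A; apply/propext; rewrite type_filter_ltrans.
by under [X in type_filter p X]eq_set do rewrite mul1g.
Qed.

Lemma ltransM g h p : ltrans (g * h)%g p = ltrans g (ltrans h p).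
Proof.
apply: SG_eq; apply/funext => A; apply/propext; rewrite !type_filter_ltrans /=.
by under [X in type_filter p X]eq_set do rewrite -mulgA.
Qed.

Lemma ltrans_tpG g h : ltrans g (tpG D h) = tpG D (g * h)%g.
Proof.
have H x y A :
    type_filter (ltrans x (tpG D y)) A -> type_filter (tpG D (x * y)%g) A.
  rewrite type_filter_ltrans => -[phi phiy phiA].
  exists (Ftrans x^-1%g phi); rewrite /= /trace /= ?/tp /=.
    by apply/(definesE _ (defines_Ftrans _ phi)); rewrite /= mulKg.
  move=> z; rewrite /= (definesE _ (defines_Ftrans _ phi)) /=.
  by move=> /phiA /=; rewrite mulVKg.
apply: SG_eq; apply/funext => A; apply/propext; split; first exact: H.
move=> HA; rewrite type_filter_ltrans.
(* The reverse inclusion is [H] applied to the inverse of [g] and to [g * h]. *)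
have /H : type_filter (ltrans g^-1%g (tpG D (g * h)%g)) [set x | A (g * x)%g].
  rewrite type_filter_ltrans /=.
  by under [X in type_filter _ X]eq_set do rewrite mulVKg.
by rewrite mulKg.
Qed.

Lemma type_filter_tpG g A : type_filter (tpG D g) A -> A g.
Proof. by move=> [phi phig]; apply. Qed.

Lemma tpG_type_filter g V : definable D V -> V g -> type_filter (tpG D g) V.
Proof.
move=> [phi phiV] Vg; exists phi; last by rewrite (defines_traceE phiV).
exact/(definesE _ phiV).
Qed.

Lemma definable_smul U V :
  definable D U -> definable D V -> definable D (smul U V).
Proof.
move=> [phi phiU] [psi psiV].
(* The blocks of variables are the left factor, the right factor and the product; the two
   applications of [Fexn] bind the factors in this order. *)
pose f : formula L M (n + (n + n)) := Fand (dg_mul D)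
  (Fand (subst phi (fun i => Tvar (lshift (n + n) i)))
        (subst psi (fun i => Tvar (rshift n (lshift n i))))).
have fP a b c : sat id f (fcat a (fcat b c)) <->
    [/\ sat id (dg_mul D) (fcat a (fcat b c)), sat id phi a & sat id psi b].
  rewrite /= !sat_subst.
  under [X in sat id phi X]eq_fun do rewrite /= fcat_lshift.
  under [X in sat id psi X]eq_fun do rewrite /= fcat_rshift fcat_lshift.
  by split=> [[? []]|[]].
exists (Fexn (Fexn (f : formula L M (n + (n + n))))) => c.
rewrite sat_Fexn; split.
  move=> [b /sat_Fexn[a /fP[/dg_mulP[g [h [-> -> ->]]] ag bh]]].
  exists (g * h)%g => //; exists g; first exact/(definesE _ phiU).
  by exists h => //; exact/(definesE _ psiV).
move=> [_ [g Ug [h Vh <-]] <-]; exists (iota h); apply/sat_Fexn.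
exists (iota g); apply/fP; split.
- by apply/dg_mulP; exists g, h.
- exact/(definesE _ phiU).
- exact/(definesE _ psiV).
Qed.

Lemma open_type_filter A : open [set p | type_filter p A].
Proof.
by move=> p [phi pphi phiA]; exists phi; split=> // q /= qphi; exists phi.
Qed.

(** An ultrafilter [F] converges to the type [S] made of the formulas that belong to [F]-almost all
    types. *)
Lemma SG_compact : compact [set: SG D].
Proof.
rewrite compact_ultra => F FU _.
pose S : set (formula L M n) := [set phi | F [set q : SG D | SG_val q phi]].
have SI phi psi : S phi -> S psi -> S (Fand phi psi).
  apply: filterS2 => q qphi qpsi; exact/(is_SG_and _ _ (SG_prop q)).
have Sdom : S (dg_dom D).
  by apply: filterS filterT => q _; exact: (SG_prop q).2.
(* The solution sets of [S] generate a proper filter: a formula of [S] lies in some type, hence has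
   a point in the group. This gives the consistency of [S]. *)
pose H : set_system ('I_n -> M) :=
  fun X => exists2 phi, S phi & [set a | sat id phi a] `<=` X.
have HF : ProperFilter H.
  split.
    move=> [phi Sphi phi0]; have [q /SG_sat[x]] := filter_ex Sphi.
    exact: phi0.
  split.
  - by exists (dg_dom D).
  - move=> A B [phi Sphi phiA] [psi Spsi psiB].
    exists (Fand phi psi); first exact: SI.
    by move=> a [/phiA Aa /psiB Ba].
  - by move=> A B AB [phi Sphi phiA]; exists phi => // a /phiA/AB.
have SSG : is_SG D S.
  split=> //; split.
    by apply: filter_consistent HF _ => phi Sphi; exists phi.
  move=> phi.
  have [|Fphi] := in_ultra_setVsetC [set q : SG D | SG_val q phi] FU.
    by left.
  right; apply: filterS Fphi => q /= qphi.
  by have [] := (SG_prop q).1.2 phi.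
exists (MkSG SSG); split=> // A; rewrite nbhsE => -[O [oO OS] OA].
have [phi [Sphi phiO]] := oO _ OS.
by apply: filterS Sphi => q /phiO/OA.
Qed.

End Types.

(** * Neighborhoods of the identity in a topological group *)

Section TopologicalGroupFacts.
Context (G : topologicalGroupType).
Implicit Types (g : G) (U : set G).

Lemma nbhs_mulg x y U : nbhs (x * y)%g U -> exists A B : set G,
  [/\ nbhs x A, nbhs y B & forall a b, A a -> B b -> U (a * b)%g].
Proof.
move=> /(@mulg_continuous G (x, y))[[A B] /= [xA yB] AB].
by exists A, B; split=> // a b Aa Bb; exact: (AB (a, b)).
Qed.

Lemma mulgl_continuous g : continuous (fun x : G => (g * x)%g).
Proof.
move=> x U /nbhs_mulg[A [B [/nbhs_singleton Ag xB AB]]].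
by apply: filterS xB => y; exact: AB.
Qed.

Lemma mulgr_continuous g : continuous (fun x : G => (x * g)%g).
Proof.
move=> x U /nbhs_mulg[A [B [xA /nbhs_singleton Bg AB]]].
by apply: filterS xA => y Ay; exact: AB.
Qed.

Lemma nbhs1_mul U : nbhs (1%g : G) U ->
  exists2 V, nbhs (1%g : G) V & smul V V `<=` U.
Proof.
rewrite -{1}(mul1g 1%g) => /nbhs_mulg[A [B [A1 B1 AB]]].
exists (A `&` B); first exact: filterI.
by move=> _ [x [Ax _] [y [_ By] <-]]; exact: AB.
Qed.

Lemma nbhs1_inv U : nbhs (1%g : G) U -> nbhs (1%g : G) [set x | U x^-1%g].
Proof. by move=> U1; apply: (@invg_continuous G 1%g U); rewrite invg1. Qed.

Lemma nbhs1_conj g U : nbhs (1%g : G) U ->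
  nbhs (1%g : G) [set x | U (g * x * g^-1)%g].
Proof.
move=> U1; apply: (@mulgl_continuous g 1%g [set y | U (y * g^-1)%g]).
apply: (@mulgr_continuous g^-1%g (g * 1)%g U).
by rewrite mulg1 mulgV.
Qed.

Lemma nbhs1_transl g U : nbhs (1%g : G) U -> nbhs g [set x | U (x * g^-1)%g].
Proof. by move=> U1; apply: (@mulgr_continuous g^-1%g g U); rewrite mulgV. Qed.

Lemma nbhs_transl1 g U : nbhs g U -> nbhs (1%g : G) [set x | U (x * g)%g].
Proof. by move=> Ug; apply: (@mulgr_continuous g 1%g U); rewrite mul1g. Qed.

End TopologicalGroupFacts.

(** * The filter of mu . p and the equivalence of types *)

Section Infinitesimal.
Context (L : language) (M : structure L) (G : topologicalGroupType).
Context (D : definable_group M G).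
Context (G_basis : exists B : set (set G),
  basis B /\ forall U : set G, B U -> definable D U).
Local Notation n := (dg_dim D).
Local Notation iota := (dg_point D).
Implicit Types (phi psi chi : formula L M n) (U V A B : set G) (p q r : SG D).

Lemma nbhs_definable g A : nbhs g A ->
  exists U, [/\ open U, U g, definable D U & U `<=` A].
Proof.
case: G_basis => B [[Bo Bb] BD] /(Bb g)[U [BU Ug] UA].
by exists U; split=> //; [exact: Bo|exact: BD].
Qed.

(** The filter on the group attached to mu . p, written as the image of a product filter under
    multiplication so that properness is inherited. *)
Definition mu_filter p : set_system G :=
  (fun xy : G * G => (xy.1 * xy.2)%g) @
    filter_prod (nbhs (1%g : G)) (type_filter p).

Lemma mu_filterP p A : mu_filter p A <->
  exists U V, [/\ nbhs (1%g : G) U, type_filter p V & smul U V `<=` A].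
Proof.
split=> [[[U V] /= [U1 pV] UVA]|[U [V [U1 pV UVA]]]].
  exists U, V; split=> // _ [x Ux [y Vy <-]].
  exact: (UVA (x, y)).
exists (U, V) => // -[x y] [/= Ux Vy]; apply: UVA.
by exists x => //; exists y.
Qed.

Global Instance mu_filter_proper p : ProperFilter (mu_filter p).
Proof. exact: fmap_proper_filter. Qed.

Lemma mu_filter_definable p A : mu_filter p A ->
  exists U V, [/\ open U, U 1%g, definable D U, definable D V &
    type_filter p V /\ smul U V `<=` A].
Proof.
move=> /mu_filterP[U [V [/nbhs_definable[U' [oU' U'1 dU' U'U]]]]].
move=> /type_filter_definable[V' [dV' pV' V'V]] UVA.
exists U', V'; split=> //; split=> // _ [x /U'U Ux [y /V'V Vy <-]].
by apply: UVA; exists x => //; exists y.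
Qed.

Lemma mu_filter_type_filter p A : mu_filter p A -> type_filter p A.
Proof.
move=> /mu_filterP[U [V [U1 pV UVA]]]; apply: filterS pV => x Vx; apply: UVA.
by exists 1%g; [exact: nbhs_singleton|exists x => //; rewrite mul1g].
Qed.

(** The neighborhood filter of 1, pushed forward to [M^n], contains the solution sets of mu, so
    [entails_filter] applies to it. *)
Lemma entails_mu phi U : defines D phi U -> entails (@mu L M G D) phi ->
  nbhs (1%g : G) U.
Proof.
move=> phiU /(entails_filter (F := iota @ nbhs (1%g : G))) H.
rewrite -(defines_traceE phiU); apply: H => psi [V [oV V1 psiV]] /=.
rewrite (_ : _ @^-1` _ = V); first exact: open_nbhs_nbhs.
exact: defines_traceE psiV.
Qed.

Lemma entails_type p phi : entails p phi -> SG_val p phi.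
Proof.
move=> pphi; have [|] := (SG_prop p).1.2 phi => // npphi.
have [[[N [h [a [hh ap]]]] _] _] := SG_prop p.
by have := ap _ npphi; rewrite /= => nphi; case: nphi; apply: pphi hh _ ap.
Qed.

Lemma mu_prodP p chi : mu_prod p chi ->
  exists2 W, defines D chi W & mu_filter p W.
Proof.
move=> [phi [psi [U [V [[phiU muU] [psiV pV] chiUV]]]]].
exists (smul U V) => //; apply/mu_filterP; exists U, V; split=> //.
  exact: entails_mu phiU muU.
exists psi; first exact: entails_type.
by rewrite (defines_traceE psiV).
Qed.

Lemma mu_prodI p U V : open U -> U 1%g -> definable D U -> definable D V ->
  type_filter p V ->
  exists2 chi, defines D chi (smul U V) & mu_prod p chi.
Proof.
move=> oU U1 dU dV pV; have [chi chiP] := definable_smul dU dV.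
case: dU dV => [phi phiU] [psi psiV].
exists chi => //; exists phi, psi, U, V; split=> //; split=> //.
  by move=> N h hh a; apply; exists U.
move=> N h hh a; apply; apply/type_filterP.
by rewrite (defines_traceE psiV).
Qed.

(** From entailment to inclusion, compactness is applied to the filter of [q] pushed forward to
    [M^n]. Conversely, a single formula of mu . q already implies the given one, and the implication
    passes to elementary extensions. *)
Lemma entails_mu_prod p q :
  (forall phi, mu_prod p phi -> entails (mu_prod q) phi) <->
  mu_filter p `<=` mu_filter q.
Proof.
split=> [H A|H chi /mu_prodP[W chiW /H]].
  move=> /mu_filter_definable[U [V [oU U1 dU dV [pV UVA]]]].
  apply: filterS UVA _.
  have [chi chiUV] := mu_prodI oU U1 dU dV pV.
  move=> /H/(entails_filter (F := iota @ mu_filter q)) {}H.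
  rewrite -(defines_traceE chiUV); apply: H => psi /mu_prodP[W psiW qW] /=.
  by rewrite (_ : _ @^-1` _ = W) //; exact: defines_traceE psiW.
move=> /mu_filter_definable[U [V [oU U1 dU dV [qV UVW]]]].
have [psi psiUV qpsi] := mu_prodI oU U1 dU dV qV.
move=> N h hh a aq; apply: elementary_impl hh _ _ (aq _ qpsi) => b.
by move=> /psiUV[x /UVW Wx <-]; apply/chiW; exists x.
Qed.

Lemma mu_equivP p q : mu_equiv p q <-> mu_filter p = mu_filter q.
Proof.
split=> [[qp pq]|pq].
  by rewrite eqEsubset; split; exact/entails_mu_prod.
by split; apply/entails_mu_prod; rewrite pq.
Qed.

(** By compactness this amounts to realizations of [p] and [q] differing by an infinitesimal left
    factor; symmetry comes from inverting that factor. *)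
Definition mu_close p q := forall U A B,
  nbhs (1%g : G) U -> type_filter p A -> type_filter q B ->
  exists x y, [/\ U x, A y & B (x * y)%g].

Lemma mu_close_sym p q : mu_close p q -> mu_close q p.
Proof.
move=> pq U A B /nbhs1_inv U1 qA pB.
have [x [y [Ux By Axy]]] := pq _ _ _ U1 pB qA.
by exists x^-1%g, (x * y)%g; rewrite mulKg.
Qed.

Lemma mu_close_sub p q : mu_close p q -> mu_filter p `<=` mu_filter q.
Proof.
move=> pq A /mu_filterP[U [V [U1 pV UVA]]].
have [U' /nbhs_definable[W [oW W1 dW WU']] U'U] := nbhs1_mul U1.
have [V' [dV' pV' V'V]] := type_filter_definable pV.
have {}W1 : nbhs 1%g W by exact: open_nbhs_nbhs.
apply/mu_filterP; exists W, (smul W V'); split=> //.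
  (* Otherwise the complement of the definable set [smul W V'] belongs to [q], and closeness gives a
     point of [smul W V'] in it. *)
  apply: contrapT => /(type_filter_setC (definable_smul dW dV')) qC.
  have [x [y [Wx Vy]]] := pq _ _ _ W1 pV' qC.
  by apply; exists x => //; exists y.
move=> _ [x /WU' Ux [_ [y /WU' Uy [z /V'V Vz <-]] <-]]; apply: UVA.
rewrite mulgA; exists (x * y)%g; last by exists z.
by apply: U'U; exists x => //; exists y.
Qed.

Lemma mu_closeP p q : mu_equiv p q <-> mu_close p q.
Proof.
rewrite mu_equivP; split=> [pq U A B U1 pA qB|pq].
  have : mu_filter q (smul U A).
    by rewrite -pq; apply/mu_filterP; exists U, A; split=> // x.
  move=> /mu_filter_type_filter qUA.
  have [z [[x Ux [y Ay xyz]] Bz]] : (smul U A `&` B) !=set0.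
    by apply: (@filter_ex _ (type_filter q)); exact: filterI.
  by exists x, y; rewrite xyz.
by rewrite eqEsubset; split; apply: mu_close_sub => //; exact: mu_close_sym.
Qed.

(** Since g (x y) = (g x g^-1) (g y) and conjugation preserves the neighborhoods of 1, translation
    by [g] passes through the infinitesimal factor. *)
Lemma mu_filter_ltrans g p A :
  mu_filter (ltrans g p) A <-> mu_filter p [set x | A (g * x)%g].
Proof.
split=> /mu_filterP[U [V [U1 pV UVA]]]; apply/mu_filterP.
  exists [set x | U (g * x * g^-1)%g], [set x | V (g * x)%g]; split.
  - exact: nbhs1_conj.
  - exact/type_filter_ltrans.
  - move=> _ [x Ux [y Vy <-]]; apply: UVA; exists (g * x * g^-1)%g => //.
    by exists (g * y)%g => //; rewrite mulgA mulgVK mulgA.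
exists [set x | U (g^-1 * x * g^-1^-1)%g], [set x | V (g^-1 * x)%g]; split.
- exact: nbhs1_conj.
- apply/type_filter_ltrans; rewrite [X in type_filter _ X](_ : _ = V) //.
  by apply/funext => x /=; rewrite mulKg.
- move=> _ [x Ux [y Vy <-]].
  rewrite -(mulVKg g (x * y)%g); apply: UVA.
  exists (g^-1 * x * g^-1^-1)%g => //.
  by exists (g^-1 * y)%g => //; rewrite mulgA mulgVK mulgA.
Qed.

Lemma mu_equiv_ltrans g p q :
  mu_equiv p q -> mu_equiv (ltrans g p) (ltrans g q).
Proof.
rewrite !mu_equivP => pq; apply/funext => A; apply/propext.
by rewrite !mu_filter_ltrans pq.
Qed.

Lemma open_mu_filter A : open [set p | mu_filter p A].
Proof.
rewrite (_ : [set p | mu_filter p A] = \bigcup_(V in [set V | exists2 U,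
    nbhs (1%g : G) U & smul U V `<=` A]) [set p | type_filter p V]).
  by apply: bigcup_open => V _; exact: open_type_filter.
apply/seteqP; split=> [p /mu_filterP[U [V [U1 pV UVA]]]|p [V [U U1 UVA] pV]].
  by exists V => //; exists U.
by apply/mu_filterP; exists U, V.
Qed.

(* The class of [p] is the intersection of the compact sets
   [{r | U V in r}]. *)
Lemma saturated_open_basis (O : set (SG D)) p : open O -> O p ->
  (forall q r, mu_equiv q r -> O q -> O r) ->
  exists U V, [/\ nbhs (1%g : G) U, type_filter p V &
    forall r, type_filter r (smul U V) -> O r].
Proof.
move=> oO Op satO; apply: contrapT => nUV.
(* If no pair [U], [V] works, each of the sets of types containing [smul U V] has a point outside
   [O]; these remainders generate a proper filter. *)
pose F : set_system (SG D) := filter_from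
  [set UV : set G * set G | nbhs (1%g : G) UV.1 /\ type_filter p UV.2]
  (fun UV => [set r | type_filter r (smul UV.1 UV.2) /\ ~ O r]).
have FF : ProperFilter F.
  apply: filter_from_proper.
    apply: filter_from_filter.
      by exists (setT, setT); split; exact: filterT.
    move=> [U V] [U' V'] /= [U1 pV] [U'1 pV'].
    exists (U `&` U', V `&` V'); first by split; exact: filterI.
    move=> r [/= rUV nOr]; split; split=> //; apply: filterS rUV.
      by move=> _ [x [Ux _] [y [Vy _] <-]]; exists x => //; exists y.
    by move=> _ [x [_ Ux] [y [_ Vy] <-]]; exists x => //; exists y.
  move=> [U V] /= [U1 pV]; apply: contrapT => UV0; apply: nUV.
  exists U, V; split=> // r rUV; apply: contrapT => nOr.
  by apply: UV0; exists r.
(* The cluster point [r] stays outside the open set [O] and yet is close to [p], against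
   saturation. *)
have [r [_ rF]] := SG_compact FF filterT.
have nOr : ~ O r.
  move=> Or; have [q [[_ nOq] Oq]] :
      ([set q | type_filter q setT /\ ~ O q] `&` O) !=set0.
    apply: rF; last exact: open_nbhs_nbhs.
    exists (setT, setT); first by split; exact: filterT.
    by move=> q [_ nOq]; split=> //; exact: filterT.
  exact: nOq.
apply: nOr; apply: satO Op; apply/mu_closeP => U A B U1 pA rB.
have [q [[qUA _] qB]] : ([set q | type_filter q (smul U A) /\ ~ O q] `&`
    [set q | type_filter q B]) !=set0.
  apply: rF; first by exists (U, A).
  by apply: open_nbhs_nbhs; split=> //; exact: open_type_filter.
have [z [[x Ux [y Ay xyz]] Bz]] : (smul U A `&` B) !=set0.
  by apply: (@filter_ex _ (type_filter q)); exact: filterI.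
by exists x, y; rewrite xyz.
Qed.

End Infinitesimal.

(** * Topology of the quotient, the action and the embedding *)

Section Quotient.
Local Open Scope quotient_scope.
Context (L : language) (M : structure L) (G : topologicalGroupType).
Context (D : definable_group M G).
Implicit Types (p q r : SG D) (x y : Smu D).

Lemma mu_classP p q : mu_class p = mu_class q <-> mu_equiv p q.
Proof.
split=> [/(@eqmodP _ (mu_equiv_rel D))/asboolP //|pq].
by apply/(@eqmodP _ (mu_equiv_rel D))/asboolP.
Qed.

Lemma mu_class_surj x : exists p, mu_class p = x.
Proof.
by exists (repr (x : {eq_quot (mu_equiv_rel D)})); exact: reprK.
Qed.

Lemma mu_class_continuous : continuous (@mu_class L M G D).
Proof. exact: pi_continuous. Qed.

Lemma open_mu_class (O : set (Smu D)) :
  open O <-> open (@mu_class L M G D @^-1` O).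
Proof. by []. Qed.

Lemma Smu_compact : compact [set: Smu D].
Proof.
rewrite (_ : setT = @mu_class L M G D @` setT); last first.
  by apply/seteqP; split=> // x _; have [p <-] := mu_class_surj x; exists p.
apply: continuous_compact; last exact: SG_compact.
by apply: continuous_subspaceT; exact: mu_class_continuous.
Qed.

(** The preimage of a nonempty open set contains all types with some formula [phi] that belongs to a
    type; such a [phi] has a point in the group. *)
Lemma tpmu_dense : dense (range (@tpmu L M G D)).
Proof.
move=> O [x Ox] /open_mu_class oO.
have [p px] := mu_class_surj x; rewrite -px in Ox.
have [phi [pphi phiO]] := oO p Ox.
have [g phig] := SG_sat pphi.
by exists (tpmu D g); split; [exact: phiO|exists g].
Qed.

Context (G_basis : exists B : set (set G),
  basis B /\ forall U : set G, B U -> definable D U).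

Definition mu_basic (A : set G) : set (Smu D) :=
  [set x | exists2 p, mu_class p = x & mu_filter p A].

Lemma mu_basicE p A : mu_basic A (mu_class p) <-> mu_filter p A.
Proof.
split=> [[q /mu_classP/(mu_equivP G_basis) -> //]|pA].
by exists p.
Qed.

Lemma open_mu_basic A : open (mu_basic A).
Proof.
apply/open_mu_class.
rewrite (_ : _ @^-1` _ = [set p | mu_filter p A]); first exact: open_mu_filter.
by apply/seteqP; split=> p /mu_basicE.
Qed.

Lemma open_Smu_basis (O : set (Smu D)) p : open O -> O (mu_class p) ->
  exists U V, [/\ nbhs (1%g : G) U, type_filter p V &
    forall r, type_filter r (smul U V) -> O (mu_class r)].
Proof.
move=> oO Op.
apply: (saturated_open_basis G_basis (O := @mu_class L M G D @^-1` O)) => //.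
by move=> q r /mu_classP; rewrite /preimage /= => ->.
Qed.

Lemma mu_act_class g p : mu_act g (mu_class p) = mu_class (ltrans g p).
Proof.
apply/mu_classP/(mu_equiv_ltrans G_basis)/mu_classP.
exact: reprK.
Qed.

Lemma Smu_hausdorff : hausdorff_space (Smu D).
Proof.
move=> x y; have [p <-] := mu_class_surj x; have [q <-] := mu_class_surj y.
move=> pq; apply/mu_classP/(mu_closeP G_basis) => U A B U1 pA qB.
have [U' U'1 U'U] := nbhs1_mul U1.
(* [V] is the inverse of [U']. A type in both neighborhoods below yields a b = c d with a in [U']
   and c in [V], so c^-1 a lies in [smul U' U'] and carries b to d. *)
have U'V := nbhs1_inv U'1; set V := [set x | _] in U'V.
have nb r W C : nbhs (1%g : G) W -> type_filter r C ->
    nbhs (mu_class r) (mu_basic (smul W C)).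
  move=> W1 rC; apply: open_nbhs_nbhs; split; first exact: open_mu_basic.
  by apply/mu_basicE/mu_filterP; exists W, C; split=> // z.
have [z []] := pq _ _ (nb p U' A U'1 pA) (nb q V B U'V qB).
have [r <-] := mu_class_surj z => /mu_basicE rA /mu_basicE rB.
have [_ [[a Ua [b Ab <-]] [c Vc [d Bd cd]]]] : (smul U' A `&` smul V B) !=set0.
  by apply: (@filter_ex _ (mu_filter r)); exact: filterI.
exists (c^-1 * a)%g, b; split=> //.
  by apply: U'U; exists c^-1%g => //; exists a.
by rewrite -mulgA -cd mulKg.
Qed.

Lemma mu_act_continuous :
  continuous (fun gx : G * Smu D => mu_act gx.1 gx.2).
Proof.
move=> [g x] N; have [p <-] := mu_class_surj x.
move=> gpN.
have {gpN} : nbhs (mu_class (ltrans g p)) N by rewrite -mu_act_class.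
rewrite nbhsE => -[O [oO Op] ON].
have [U [V [U1 pV UVO]]] := open_Smu_basis oO Op.
have [W W1 WU] := nbhs1_mul U1.
(* For h in W g and g z in W V, the product h z = (h g^-1) (g z) lies in W W V, hence in U V. *)
exists ([set h | W (h * g^-1)%g], mu_basic [set y | smul W V (g * y)%g]).
  split; first exact: nbhs1_transl.
  apply: open_nbhs_nbhs; split; first exact: open_mu_basic.
  apply/mu_basicE/mu_filter_ltrans/mu_filterP; exists W, V; split=> // z.
move=> [h y] /= [Wh]; have [r <-] := mu_class_surj y => /mu_basicE rWV.
apply: ON; rewrite /= mu_act_class; apply: UVO; apply/type_filter_ltrans.
apply: filterS (mu_filter_type_filter rWV) => z [a Wa [b Vb ab]].
exists (h * g^-1 * a)%g.
  by apply: WU; exists (h * g^-1)%g => //; exists a.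
by exists b => //; rewrite -mulgA ab -mulgA mulKg.
Qed.

Lemma mu_act_tpmu g h : mu_act g (tpmu D h) = tpmu D (g * h)%g.
Proof. by rewrite mu_act_class ltrans_tpG. Qed.

Lemma tpmu_continuous : continuous (@tpmu L M G D).
Proof.
move=> g N gN.
have {gN} : nbhs (mu_act g (tpmu D 1%g)) N by rewrite mu_act_tpmu mulg1.
move=> /(@mu_act_continuous (g, tpmu D 1%g))[[A B] /= [gA B1] AB].
have gA' : nbhs g A by []; apply: filterS gA' => h Ah.
have := AB (h, tpmu D 1%g) (conj Ah (@nbhs_singleton (Smu D) _ _ B1)).
by rewrite /= mu_act_tpmu mulg1.
Qed.

(** With W W g inside [A], a definable neighborhood [V] of [g] inside W g belongs to the type of
    [g], and W V is inside [A]. Together with [mu_basic_tpmu], this shows that an open [A] is the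
    preimage of [mu_basic A] under [tpmu]. *)
Lemma tpmu_basic g A : nbhs g A -> mu_basic A (tpmu D g).
Proof.
move=> /nbhs_transl1/nbhs1_mul[W W1 WA]; apply/mu_basicE/mu_filterP.
have [V [_ Vg dV VW]] := nbhs_definable G_basis (nbhs1_transl g W1).
exists W, V; split=> //; first exact: tpG_type_filter.
move=> _ [x Wx [y /VW /= Wy <-]].
have /WA /= : smul W W (x * (y * g^-1))%g.
  by exists x => //; exists (y * g^-1)%g.
by rewrite -mulgA mulgVK.
Qed.

Lemma mu_basic_tpmu g A : mu_basic A (tpmu D g) -> A g.
Proof.
by move=> /mu_basicE/mu_filter_type_filter; exact: type_filter_tpG.
Qed.

Lemma tpmu_embedding : hausdorff_space G ->
  topological_embedding (@tpmu L M G D).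
Proof.
move=> G_hausdorff; split; [|exact: tpmu_continuous|].
(* When the classes coincide, every neighborhood of [g] contains [h]. *)
- move=> g h gh; apply: G_hausdorff => A B /tpmu_basic.
  rewrite gh => /mu_basic_tpmu Ah hB.
  by exists h; split=> //; exact: nbhs_singleton.
- move=> U oU; exists (mu_basic U); first exact: open_mu_basic.
  apply/seteqP; split=> [_ [g Ug <-]|_ [/[swap] -[g _ <-] /mu_basic_tpmu Ug]].
    by split; [apply/tpmu_basic/open_nbhs_nbhs|exists g].
  by exists g.
Qed.

End Quotient.

Theorem theorem1p2 (L : language) (M : structure L)
    (G : topologicalGroupType) (D : definable_group M G)
    (G_hausdorff : hausdorff_space G)
    (G_basis : exists B : set (set G),
       basis B /\ forall U : set G, B U -> definable D U) :
  [/\ compact [set: Smu D],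
      hausdorff_space (Smu D),
      [/\ forall (g : G) (p : SG D),
            mu_act g (mu_class p) = mu_class (ltrans g p),
          forall x : Smu D, mu_act 1%g x = x,
          forall (g h : G) (x : Smu D),
            mu_act (g * h)%g x = mu_act g (mu_act h x) &
          continuous (fun gx : G * Smu D => mu_act gx.1 gx.2)],
      topological_embedding (@tpmu L M G D) &
      dense (range (@tpmu L M G D))].
Proof.
split.
- exact: Smu_compact.
- exact: Smu_hausdorff.
- split.
  + exact: mu_act_class.
  + by move=> x; have [p <-] := mu_class_surj x; rewrite mu_act_class ?ltrans1.
  + move=> g h x; have [p <-] := mu_class_surj x.
    by rewrite !mu_act_class // ltransM.
  + exact: mu_act_continuous.
- exact: tpmu_embedding.
- exact: tpmu_dense.
Qed.
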